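(* Let $F$ be an Archimedean vector lattice. The following conditions are equivalent: (i) $F$ is atomic; (ii) every order interval in $F$ is order pre-compact; (iii) order convergence on order intervals of $F$ is topological (that is, for every order interval $I$ of $F$, order convergence on the lattice $I$ is topological).
   Context: For $p\le q$ in a lattice $P$ the order interval is $[p,q]=\{r\in P : p\le r\le q\}$. An element $f>0$ of a vector lattice $F$ is an atom if $[0,f]$ consists of scalar multiples of $f$; $F$ is atomic if for every $g>0$ the interval $[0,g]$ contains an atom. A filter on a set $\Omega$ is a (proper, nonempty) filter of subsets of $\Omega$; an ultrafilter is a maximal such filter. A filter $\mathcal{F}$ on a lattice $P$ order converges to $p\in P$ if $\mathcal{F}$ contains a collection of order intervals of $P$ whose intersection is $\{p\}$. Equivalently, in terms of nets: $(p_\alpha)$ order converges to $p$ if there are an increasing net $(q_\beta)_{\beta\in B}$ and a decreasing net $(r_\beta)_{\beta\in B}$ in $P$ with $\bigvee_\beta q_\beta=p=\bigwedge_\beta r_\beta$ such that for every $\beta$ there is $\alpha_0$ with $q_\beta\le p_\alpha\le r_\beta$ for all $\alpha\ge\alpha_0$. (An order interval of $F$ is regarded as a lattice; order convergence in it agrees with order convergence in $F$.) Order convergence on $P$ is topological if there is a topology on $P$ such that a net (equivalently, a filter) in $P$ order converges to $p\in P$ iff it converges to $p$ in this topology. A net $(p_\alpha)$ in an order interval $I$ of $F$ is order Cauchy if the net $(p_\alpha-p_\beta)_{(\alpha,\beta)}$ order converges to $0$ in $F$; a filter $\mathcal{F}$ on $I$ is order Cauchy if the filter generated by the sets $X-Y=\{x-y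 : x\in X,y\in Y\}$, $X,Y\in\mathcal{F}$, order converges to $0$ in $F$. $I$ is order pre-compact if every ultrafilter on $I$ is order Cauchy (equivalently, every net in $I$ has an order Cauchy subnet). *)

(* Defs.v *)
From HB Require Import structures.
From mathcomp Require Import all_boot all_order all_algebra.
From mathcomp Require Import all_classical all_reals all_analysis.

Set Implicit Arguments.
Unset Strict Implicit.
Unset Printing Implicit Defensive.

Import Order.TTheory GRing.Theory Num.Theory.

Local Open Scope classical_set_scope.
Local Open Scope ring_scope.

(* HB rejects a join of Order.Lattice and GRing.Zmodule declared after         *)
(* Num.RealDomain, so the lattice operations are part of the mixin below       *)
(* instead of being inherited from Order.Lattice.                              *)
HB.mixin Record isVectorLattice (R : realType) F
    of GRing.Lmodule R F & Num.POrderedZmodule F := {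
  vmeet : F -> F -> F;
  vjoin : F -> F -> F;
  lev_meet : forall x y z : F, (x <= vmeet y z) = (x <= y) && (x <= z);
  vjoin_le : forall x y z : F, (vjoin x y <= z) = (x <= z) && (y <= z);
  lev_add2r : forall z x y : F, x <= y -> x + z <= y + z;
  lev_wscale2l : forall (a : R) (x y : F), 0 <= a -> x <= y -> a *: x <= a *: y
}.

#[short(type="vectorLatticeType")]
HB.structure Definition VectorLattice (R : realType) :=
  { F of GRing.Lmodule R F & Num.POrderedZmodule F & isVectorLattice R F }.

Section VectorLatticeNotions.
Context {R : realType}.
Implicit Types F : vectorLatticeType R.

Definition archimedean_lattice F :=
  forall x y : F, 0 <= x -> (forall n : nat, x *+ n <= y) -> x = 0.

Definition atom F (f : F) :=
  0 < f /\ forall g : F, 0 <= g <= f -> exists c : R, g = c *: f.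

Definition atomic F :=
  forall g : F, 0 < g -> exists2 f : F, 0 <= f <= g & atom f.

End VectorLatticeNotions.

Arguments archimedean_lattice {R} F.
Arguments atomic {R} F.

(* The notions in this section depend only on the order of P; they are used    *)
(* for P a vector lattice or one of its order intervals, which are lattices.   *)
Section OrderConvergence.
Context {d : Order.disp_t}.
Implicit Types P : porderType d.
Local Open Scope order_scope.

Definition order_interval P (a b : P) : pred P := fun r => a <= r <= b.

Definition order_cvg P (G : set_system P) (p : P) :=
  exists C : set (set P),
    [/\ C `<=` G,
        forall A, C A -> exists a b, a <= b /\ A = [set` order_interval a b] &
        \bigcap_(A in C) A = [set p]].

Definition order_cvg_topological P :=
  exists tau : Topological P,
    forall (G : set_system P) (p : P), ProperFilter G ->
      order_cvg G p <-> G --> (p : Topological.Pack tau).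

End OrderConvergence.

Section OrderIntervalType.
Context {d : Order.disp_t} {P : porderType d} (a b : P).

Record order_interval_type :=
  OrderInterval { oi_val : P; oi_valP : order_interval a b oi_val }.

HB.instance Definition _ := [isSub for oi_val].
HB.instance Definition _ := [Choice of order_interval_type by <:].
HB.instance Definition _ :=
  [SubChoice_isSubPOrder of order_interval_type by <: with d].

End OrderIntervalType.

Section OrderCauchy.
Context {R : realType} {F : vectorLatticeType R} (a b : F).
Notation I := (order_interval_type a b).

Definition difference_filter (G : set_system I) : set_system F :=
  filter_from [set XY : set I * set I | G XY.1 /\ G XY.2]
    (fun XY => [set (oi_val x : F) - oi_val y | x in XY.1 & y in XY.2]).

Definition order_cauchy (G : set_system I) :=
  order_cvg (difference_filter G) 0.

Definition order_precompact :=
  forall G : set_system I, UltraFilter G -> order_cauchy G.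

End OrderCauchy.

(* Main.v *)
(* In an Archimedean vector lattice every x >= 0 splits as                     *)
(* x = s e + x' with x' disjoint from the atom e, where s is the largest       *)
(* scalar with s e <= x; both s and x' are monotone in x.  If F is atomic and  *)
(* w = b - a, the elements c e + (w - s(w) e), for e an atom and c > 0, have   *)
(* infimum 0 and dominate x - y as soon as the e-coordinates of x, y in [a, b] *)
(* differ by at most c.  So on [a, b] order convergence is coordinatewise      *)
(* convergence, which is topological, and the coordinates of an ultrafilter    *)
(* converge by compactness of real segments.                                   *)
(*                                                                             *)
(* Conversely let [0, g] contain no atom, so that every 0 < h <= g has two     *)
(* disjoint nonzero minorants.                                                 *)
(* - Finitely many elements 0 < v <= g have pairwise disjoint nonzero          *)
(*   minorants, which yields x in [0, g] with v <= x false for some of the v   *)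
(*   and x <= g - v false for the others; hence some ultrafilter on [0, g] has *)
(*   only members with supremum g and infimum 0.  It is not order Cauchy.      *)
(* - If order convergence were topological, the neighbourhood filter of 0      *)
(*   would order converge to 0, so some [0, t] not containing g would be a     *)
(*   neighbourhood of 0.  But there is a disjoint sequence outside [0, t]      *)
(*   (multiples, cut at g, of a disjoint sequence below g - t), and every      *)
(*   disjoint sequence in [0, g] order converges to 0.                         *)
Require Import Defs.
From HB Require Import structures.
From mathcomp Require Import all_boot all_order all_algebra.
From mathcomp Require Import lra.
From mathcomp Require Import all_classical all_reals all_analysis.

Set Implicit Arguments.
Unset Strict Implicit.
Unset Printing Implicit Defensive.

Import Order.TTheory GRing.Theory Num.Theory.
Import numFieldNormedType.Exports.

Local Open Scope classical_set_scope.
Local Open Scope ring_scope.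

(** Both halves rest on disjointness, [vmeet x y = 0]. In the atomic case [subv_le_coord] bounds a
    difference of two points of an interval by a single coordinate plus an error independent of the
    points, and [atomic_le0] shows that these bounds have infimum 0; this yields
    [atomic_order_precompact] and, through [order_cvg_coord] and [coord_order_cvg], the topology of
    coordinatewise convergence. If [F] is not atomic, some [[0, g]] with [g > 0] is atom-free. There
    [disjoint_split] produces disjoint pieces and [archi_cut] says that large multiples of a piece
    leave no room for it below [g]. Finitely many pieces give [atom_free_spread_ultrafilter],
    against pre-compactness; infinitely many give, with [disjoint_seq_order_cvg], a sequence
    incompatible with a topology. *)

Section VectorLatticeTheory.
Context {R : realType} {F : vectorLatticeType R}.
Implicit Types (x y z e f g h k w u v : F) (c : R).

(** * Order arithmetic and disjointness *)

Lemma lev_addP z x y : (x + z <= y + z) = (x <= y).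
Proof.
apply/idP/idP => [/(lev_add2r (- z))|]; last exact: lev_add2r.
by rewrite !addrK.
Qed.

Lemma lev_subl_addr x y z : (x - y <= z) = (x <= z + y).
Proof. by rewrite -[LHS](lev_addP y) subrK. Qed.

Lemma lev_subr_addr x y z : (x <= z - y) = (x + y <= z).
Proof. by rewrite -[LHS](lev_addP y) subrK. Qed.

Lemma subv_ge0 x y : (0 <= y - x) = (x <= y).
Proof. by rewrite lev_subr_addr add0r. Qed.

Lemma lev_add x y z w : x <= y -> z <= w -> x + z <= y + w.
Proof.
move=> xy zw; apply: (@le_trans _ _ (y + z)); first by rewrite lev_addP.
by rewrite ![y + _]addrC lev_addP.
Qed.

Lemma lev_opp2 x y : (- x <= - y) = (y <= x).
Proof. by rewrite -[LHS]subv_ge0 opprK addrC subv_ge0. Qed.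

Lemma lev_addr x y : (x <= x + y) = (0 <= y).
Proof. by rewrite -[LHS](lev_addP (- x)) subrr addrC addKr. Qed.

Lemma lev_subl x y : (x - y <= x) = (0 <= y).
Proof. by rewrite lev_subl_addr lev_addr. Qed.

Lemma addv_ge0 x y : 0 <= x -> 0 <= y -> 0 <= x + y.
Proof. by move=> x0 y0; rewrite -[0]addr0; exact: lev_add. Qed.

Lemma scalev_ge0 c x : 0 <= c -> 0 <= x -> 0 <= c *: x.
Proof. by move=> c0 /(lev_wscale2l _ _ _ c0); rewrite scaler0. Qed.

Lemma lev_scale2l c x y : 0 < c -> (c *: x <= c *: y) = (x <= y).
Proof.
move=> c0; apply/idP/idP => [|xy]; last exact/lev_wscale2l/xy/ltW.
have ci : 0 <= c^-1 by rewrite invr_ge0 ltW.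
move=> /(lev_wscale2l _ _ _ ci).
by rewrite !scalerA mulVf ?gt_eqF// !scale1r.
Qed.

Lemma lev_scale2r x c d : 0 < x -> (c *: x <= d *: x) = (c <= d).
Proof.
move=> x0; rewrite -[LHS]subv_ge0 -scalerBl.
have [cd|dc] := leP c d; first by rewrite scalev_ge0 ?subr_ge0// ltW.
apply/negbTE/negP => cx; suff x_eq0 : x = 0 by rewrite x_eq0 ltxx in x0.
apply/eqP; rewrite eq_le (ltW x0) andbT.
rewrite -(@lev_scale2l (c - d)) ?subr_gt0// scaler0.
by rewrite -lev_opp2 oppr0 -scaleNr opprB.
Qed.

Lemma vmeet_lel x y : vmeet x y <= x.
Proof. by have := lexx (vmeet x y); rewrite lev_meet => /andP[]. Qed.

Lemma vmeet_ler x y : vmeet x y <= y.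
Proof. by have := lexx (vmeet x y); rewrite lev_meet => /andP[]. Qed.

Lemma vmeet_ge0 x y : 0 <= x -> 0 <= y -> 0 <= vmeet x y.
Proof. by rewrite lev_meet => -> ->. Qed.

Lemma vmeetC x y : vmeet x y = vmeet y x.
Proof. by apply/le_anti; rewrite !lev_meet !vmeet_ler !vmeet_lel. Qed.

Lemma vmeet_l x y : x <= y -> vmeet x y = x.
Proof. by move=> xy; apply/le_anti; rewrite vmeet_lel lev_meet lexx xy. Qed.

Lemma vmeetDr x y z : vmeet (x + z) (y + z) = vmeet x y + z.
Proof.
apply/le_anti; rewrite -lev_subl_addr !lev_meet !lev_subl_addr.
by rewrite vmeet_lel vmeet_ler !lev_addP vmeet_lel vmeet_ler.
Qed.

Lemma vmeetZ c x y : 0 < c -> vmeet (c *: x) (c *: y) = c *: vmeet x y.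
Proof.
move=> c0; apply/le_anti; rewrite lev_meet !lev_scale2l// vmeet_lel vmeet_ler.
set m := vmeet _ _; have mE : m = c *: (c^-1 *: m).
  by rewrite scalerA mulfV ?gt_eqF// scale1r.
by rewrite andbT mE lev_scale2l// lev_meet -(@lev_scale2l c _ x c0)
  -(@lev_scale2l c _ y c0) -mE vmeet_lel vmeet_ler.
Qed.

Lemma vmeet_subadd x y z : 0 <= x -> 0 <= y -> 0 <= z ->
  vmeet x (y + z) <= vmeet x y + vmeet x z.
Proof.
move=> x0 y0 z0; rewrite -lev_subl_addr lev_meet; apply/andP; split.
  by rewrite lev_subl_addr (le_trans (vmeet_lel _ _))// lev_addr vmeet_ge0.
rewrite lev_subl_addr [y + vmeet _ _]addrC -lev_subl_addr lev_meet.
rewrite !lev_subl_addr.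
by rewrite (le_trans (vmeet_lel _ _)) ?lev_addr// [z + y]addrC vmeet_ler.
Qed.

Lemma disjointW x x' y y' : 0 <= x' -> x' <= x -> 0 <= y' -> y' <= y ->
  vmeet x y = 0 -> vmeet x' y' = 0.
Proof.
move=> x'0 x'x y'0 y'y xy; apply/le_anti; rewrite vmeet_ge0// andbT -xy.
by rewrite lev_meet (le_trans (vmeet_lel _ _))// (le_trans (vmeet_ler _ _)).
Qed.

Lemma disjointD x y z : 0 <= x -> 0 <= y -> 0 <= z ->
  vmeet x y = 0 -> vmeet x z = 0 -> vmeet x (y + z) = 0.
Proof.
move=> x0 y0 z0 xy xz; apply/le_anti; rewrite vmeet_ge0 ?addv_ge0// andbT.
by rewrite (le_trans (vmeet_subadd x0 y0 z0))// xy xz addr0.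
Qed.

Lemma disjointZ c x y : 0 <= x -> 0 <= y -> 0 <= c ->
  vmeet x y = 0 -> vmeet x (c *: y) = 0.
Proof.
(* The factor [c + 1] is positive and dominates both 1 and [c], so [x] and [c *: y] lie below
   disjoint multiples of [x] and [y]. *)
move=> x0 y0 c0 xy; have c1 : 0 < c + 1 by lra.
apply: (@disjointW ((c + 1) *: x) x ((c + 1) *: y)) => //.
- by rewrite scalerDl scale1r addrC lev_addr scalev_ge0.
- exact: scalev_ge0.
- by rewrite scalerDl lev_addr scale1r.
- by rewrite vmeetZ// xy scaler0.
Qed.

Lemma disjoint_sum (T : eqType) (s : seq T) (P : pred T) (k : T -> F) x :
  0 <= x -> (forall i, i \in s -> P i -> 0 <= k i /\ vmeet x (k i) = 0) ->
  0 <= \sum_(i <- s | P i) k i /\ vmeet x (\sum_(i <- s | P i) k i) = 0.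
Proof.
move=> x0 H; rewrite big_seq_cond.
apply: (big_ind (fun y => 0 <= y /\ vmeet x y = 0)).
- by split => //; rewrite vmeetC vmeet_l.
- by move=> y z [y0 xy] [z0 xz]; split; [exact: addv_ge0|exact: disjointD].
- by move=> i /andP[]; exact: H.
Qed.

(** The element [x + y - g] is below both [x] and [y], hence below their meet 0. *)
Lemma disjoint_addv_le x y g : x <= g -> y <= g -> vmeet x y = 0 -> x + y <= g.
Proof.
move=> xg yg xy; rewrite -(lev_addP (- g)) subrr -xy lev_meet.
by rewrite !lev_subl_addr [y + g]addrC !lev_add.
Qed.

Lemma disjoint_eq0 x y : x <= y -> vmeet x y = 0 -> x = 0.
Proof. by move=> xy; rewrite vmeet_l. Qed.

Lemma subv_meet_disjoint x y : vmeet (x - vmeet x y) (y - vmeet x y) = 0.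
Proof. by rewrite vmeetDr subrr. Qed.

(** * Consequences of the Archimedean property *)

Context (arch : archimedean_lattice F).

Lemma archi_nat x y : 0 < x -> exists n : nat, ~~ (n%:R *: x <= y).
Proof.
move=> x0; apply: contrapT => /forallNP H.
suff xE : x = 0 by rewrite xE ltxx in x0.
apply: (@arch x y (ltW x0)) => n; rewrite -scaler_nat.
by have /negP := H n; rewrite negbK.
Qed.

(** The Archimedean property speaks of nonnegative elements only, so it is applied to the positive
    part [x - vmeet x 0]. *)
Lemma archi_le0 x y : 0 <= y -> (forall n : nat, n%:R *: x <= y) -> x <= 0.
Proof.
move=> y0 H; have p0 : 0 <= x - vmeet x 0 by rewrite subv_ge0 vmeet_lel.
rewrite -[x](subrK (vmeet x 0)) (@arch _ y p0) ?add0r ?vmeet_ler// => n.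
rewrite -scaler_nat; case: n => [|n]; first by rewrite scale0r.
rewrite scalerBr -vmeetZ// scaler0 lev_subl_addr addrC -lev_subl_addr.
by rewrite lev_meet lev_subl lev_subl_addr add0r y0 H.
Qed.

Lemma archi_eps x y : 0 <= y -> (forall c, 0 < c -> x <= c *: y) -> x <= 0.
Proof.
move=> y0 H; apply: (@archi_le0 _ y y0) => -[|n]; first by rewrite scale0r.
have ? : (n.+1%:R : R) != 0 by rewrite pnatr_eq0.
have := H n.+1%:R^-1; rewrite invr_gt0 ltr0n => /(_ isT).
by rewrite -(@lev_scale2l n.+1%:R) ?ltr0n// scalerA mulfV// scale1r.
Qed.

(* Here and below [g - vmeet g x] is the positive part of [g - x]. *)
Lemma archi_cut g k : 0 <= g -> 0 < k ->
  exists n : nat, ~~ (k <= g - vmeet g (n%:R *: k)).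
Proof.
move=> g0 k0; apply: contrapT => /forallNP H.
have {}H n : k <= g - vmeet g (n%:R *: k).
  by have /negP := H n; rewrite negbK.
have [n /negP] := @archi_nat k g k0; apply.
(* Once [n k <= g], the positive part of [g - n k] is [g - n k] itself, so [k] below it means
   [(n + 1) k <= g]. *)
elim: n => [|n IHn]; first by rewrite scale0r.
have := H n; rewrite vmeetC vmeet_l// lev_subr_addr.
by rewrite -[n.+1]add1n natrD scalerDl scale1r.
Qed.

End VectorLatticeTheory.

Lemma fmap_ultra (T U : Type) (f : T -> U) (G : set_system T) :
  UltraFilter G -> UltraFilter (f @ G).
Proof.
move=> UG; split=> [|H PH GH]; first exact: fmap_proper_filter.
apply/seteqP; split=> // A HA.
have [//|GA] := in_ultra_setVsetC (f @^-1` A) UG.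
have : H (A `&` ~` A) by apply: filterI => //; exact: GH.
by rewrite setICr => /filter_not_empty.
Qed.

(** * Coordinates along an atom, and pre-compactness in the atomic case *)

Section AtomCoordinates.
Context {R : realType} {F : vectorLatticeType R}.
Implicit Types (x y z w e : F) (c s : R).

(** The supremum is attained when [e] is an atom and [0 <= x]; see [coordP]. *)
Definition atom_coord e x : R := sup [set c | c *: e <= x].

Context (arch : archimedean_lattice F).

(** Choose [N] with [N e <= x] false. Since [e] is an atom, the meet of [x] and [N e] is some [s e],
    and [s < N]. The differences [x - s e] and [(N - s) e] are disjoint, hence so are [x - s e] and
    [e]. *)
Lemma atom_decomposition e x : atom e -> 0 <= x ->
  exists s, [/\ 0 <= s, s *: e <= x & vmeet (x - s *: e) e = 0].
Proof.
move=> [e0 eP] x0; have [[|n] nx] := archi_nat arch x e0.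
  by rewrite scale0r x0 in nx.
have n0 : 0 < n.+1%:R :> R by rewrite ltr0n.
pose m := vmeet x (n.+1%:R *: e).
have m0 : 0 <= m by rewrite vmeet_ge0// scalev_ge0 ?ler0n// ltW.
have [|c mc] := eP (n.+1%:R^-1 *: m).
  rewrite scalev_ge0 ?invr_ge0 ?ler0n//= -(lev_scale2l _ _ n0) scalerA.
  by rewrite mulfV ?gt_eqF// scale1r vmeet_ler.
have {mc}mE : m = (n.+1%:R * c) *: e.
  by rewrite -scalerA -mc scalerA mulfV ?gt_eqF// scale1r.
set s := _ * c in mE; exists s; rewrite -mE; split.
- by rewrite -(lev_scale2r _ _ e0) scale0r -mE.
- exact: vmeet_lel.
have sn : s < n.+1%:R.
  rewrite lt_neqAle -(lev_scale2r _ _ e0) -mE vmeet_ler andbT.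
  by apply/negP => /eqP sE; move/negP: nx; apply; rewrite -sE -mE vmeet_lel.
have ns : 0 < n.+1%:R - s by rewrite subr_gt0.
have xm : 0 <= x - m by rewrite subv_ge0 vmeet_lel.
rewrite -[e in LHS]scale1r -(mulVf (lt0r_neq0 ns)) -scalerA.
apply: disjointZ; rewrite ?invr_ge0 ?(ltW ns)//.
  by rewrite scalev_ge0 ?ltW.
by rewrite scalerBl -mE subv_meet_disjoint.
Qed.

Lemma coordP e x : atom e -> 0 <= x ->
  [/\ 0 <= atom_coord e x, atom_coord e x *: e <= x,
      vmeet (x - atom_coord e x *: e) e = 0 &
      forall c, c *: e <= x -> c <= atom_coord e x].
Proof.
move=> ae x0; have [s [s0 sx xs]] := atom_decomposition ae x0.
have e0 : 0 < e by case: ae.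
have smax c : c *: e <= x -> c <= s.
  move=> cx; have [//|sc] := leP c s.
  have cs : 0 <= c - s by rewrite subr_ge0 ltW.
  (* If [c > s], then [(c - s) e] is both below [x - s e] and disjoint from it. *)
  have H : (c - s) *: e = 0.
    apply: (@disjoint_eq0 _ _ _ (x - s *: e)).
    - by rewrite scalerBl lev_addP.
    - by rewrite vmeetC disjointZ ?subv_ge0// ltW.
  by move: (lev_scale2r (c - s) 0 e0); rewrite H scale0r lexx subr_le0 leNgt sc.
suff -> : atom_coord e x = s by [].
apply/le_anti/andP; split.
  by apply: ge_sup; [exists s|exact: smax].
by apply: ub_le_sup => //; exists s; exact: smax.
Qed.

(** The remainder of [x] lies below [y], which is a multiple of [e] plus the remainder of [y]; being
    disjoint from [e], it lies below the second summand. *)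
Lemma coord_rem_le e x y : atom e -> 0 <= x -> x <= y ->
  x - atom_coord e x *: e <= y - atom_coord e y *: e.
Proof.
move=> ae x0 xy; have e0 : 0 <= e by case: ae => /ltW.
have [sx sxe x'e _] := coordP ae x0.
have [sy sye y'e _] := coordP ae (le_trans x0 xy).
set x' := x - _ in x'e *; set y' := y - _ in y'e *.
have x'0 : 0 <= x' by rewrite subv_ge0.
have y'0 : 0 <= y' by rewrite subv_ge0.
have x'y : x' <= atom_coord e y *: e + y'.
  rewrite addrC subrK (le_trans _ xy)// lev_subl scalev_ge0//.
rewrite -(vmeet_l x'y).
apply: le_trans (vmeet_subadd x'0 (scalev_ge0 sy e0) y'0) _.
by rewrite disjointZ// add0r vmeet_ler.
Qed.

Lemma coord_mono e x y : atom e -> 0 <= x -> x <= y ->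
  atom_coord e x <= atom_coord e y.
Proof.
move=> ae x0 xy; have [_ sxe _ _] := coordP ae x0.
have [_ _ _] := coordP ae (le_trans x0 xy); apply.
exact: le_trans xy.
Qed.

(** The remainder of [x] is at most that of [w], and [y] is at least its own multiple of [e]. The
    second summand depends on neither [x] nor [y]. *)
Lemma subv_le_coord e w x y : atom e -> 0 <= x -> x <= w -> 0 <= y ->
  x - y <= (atom_coord e x - atom_coord e y) *: e + (w - atom_coord e w *: e).
Proof.
move=> ae x0 xw y0; have [_ ye _ _] := coordP ae y0.
rewrite scalerBl -addrA [- _ + (_ - _)]addrC addrA; apply: lev_add.
  by rewrite [leRHS]addrC -lev_subl_addr; exact: coord_rem_le.
by rewrite lev_opp2.
Qed.

Lemma coord_dominator_ge0 e w c : atom e -> 0 <= w -> 0 <= c ->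
  0 <= c *: e + (w - atom_coord e w *: e).
Proof.
move=> ae w0 c0; have [_ we _ _] := coordP ae w0.
by rewrite addv_ge0 ?subv_ge0// scalev_ge0//; case: ae => /ltW.
Qed.

(** Otherwise some atom [e] lies below the positive part of [z], which the bounds also dominate.
    Taking [c = 1/2] gives [(1/2 + s) e <= w] for [s] the coordinate of [w], against its
    maximality. *)
Lemma atomic_le0 w z : atomic F -> 0 <= w ->
  (forall e c, atom e -> 0 < c -> z <= c *: e + (w - atom_coord e w *: e)) ->
  z <= 0.
Proof.
move=> atF w0 H; have : 0 <= z - vmeet z 0 by rewrite subv_ge0 vmeet_lel.
rewrite le_eqVlt => /predU1P[zE|z0].
  by rewrite -[z](subrK (vmeet z 0)) -zE add0r vmeet_ler.
have [e /andP[e0 ez] ae] := atF _ z0.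
have [_ we _ wmax] := coordP ae w0.
have half0 : 0 < 1 / 2 :> R by lra.
suff : 1 / 2 + atom_coord e w <= atom_coord e w by rewrite gerDr leNgt half0.
apply: wmax; rewrite scalerDl -lev_subr_addr.
have -> : (1 / 2 : R) = 1 - 1 / 2 by lra.
rewrite scalerBl scale1r lev_subl_addr [leRHS]addrC (le_trans ez)//.
rewrite lev_subl_addr [leRHS]addrC -lev_subl_addr lev_meet.
have u0 := coord_dominator_ge0 ae w0 (ltW half0).
by rewrite lev_subl u0/= lev_subl_addr add0r H.
Qed.

Lemma atomic_eq0 w z : atomic F -> 0 <= w ->
  (forall e c, atom e -> 0 < c ->
     - (c *: e + (w - atom_coord e w *: e)) <= z
       <= c *: e + (w - atom_coord e w *: e)) ->
  z = 0.
Proof.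
move=> atF w0 H; apply/le_anti; rewrite (@atomic_le0 w z)//=; last first.
  by move=> e c ae c0; have /andP[] := H e c ae c0.
rewrite -lev_opp2 oppr0 (@atomic_le0 w)// => e c ae c0.
by rewrite -lev_opp2 opprK; have /andP[] := H e c ae c0.
Qed.

Lemma atomic_order_precompact (a b : F) : atomic F -> a <= b ->
  order_precompact a b.
Proof.
move=> atF ab G UG; have w0 : 0 <= b - a by rewrite subv_ge0.
pose u e c := c *: e + (b - a - atom_coord e (b - a) *: e).
exists [set A | exists e c, [/\ atom e, 0 < c &
  A = [set` order_interval (- u e c) (u e c)]]]; split.
- move=> _ [e [c [ae c0 ->]]].
  pose s (x : order_interval_type a b) := atom_coord e (oi_val x - a).
  have oi0 (x : order_interval_type a b) : 0 <= oi_val x - a.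
    by rewrite subv_ge0; have /andP[] := oi_valP x.
  have oiw (x : order_interval_type a b) : oi_val x - a <= b - a.
    by rewrite lev_addP; have /andP[] := oi_valP x.
  have sW p : 0 <= s p <= atom_coord e (b - a).
    by rewrite coord_mono// andbT; have [] := coordP ae (oi0 p).
  (* The image of the ultrafilter under the coordinate lives on a compact segment, so it converges
     to some [l]; two points whose coordinates are within [c / 2] of [l] have coordinates differing
     by less than [c]. *)
  have := @segment_compact R 0 (atom_coord e (b - a)).
  rewrite compact_ultra => /(_ (s @ G) (fmap_ultra _ UG)) [].
    by apply: (@filterE _ G) => p /=; rewrite in_itv/=; exact: sW.
  move=> l [_ sl].
  have GX : G [set x | `|l - s x| < c / 2].
    have /cvgrPdist_lt := (sl : s @ G --> l).
    by apply; rewrite divr_gt0.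
  pose X := [set x | `|l - s x| < c / 2].
  exists (X, X); first by [].
  move=> _ [x /= xX [y /= yX <-]].
  have key (x' y' : order_interval_type a b) : X x' -> X y' ->
      oi_val x' - oi_val y' <= u e c.
    move=> x'X y'X.
    have -> : oi_val x' - oi_val y' = (oi_val x' - a) - (oi_val y' - a).
      by rewrite opprB addrA subrK.
    apply: le_trans (subv_le_coord ae (oi0 x') (oiw x') (oi0 y')) _.
    rewrite lev_addP lev_scale2r; last by case: ae.
    move: x'X y'X; rewrite /X/= -/(s x') -/(s y') !ltr_norml.
    by move: (s x') (s y') => p q; lra.
  by rewrite /order_interval unfold_in /= key// andbT -lev_opp2 opprK opprB key.
- move=> _ [e [c [ae c0 ->]]]; exists (- u e c), (u e c); split => //.
  have u0 := coord_dominator_ge0 ae w0 (ltW c0).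
  by apply: (@le_trans _ _ 0) => //; rewrite -lev_opp2 opprK oppr0.
- apply/seteqP; split => z /=.
    move=> H; apply: (atomic_eq0 atF w0) => e c ae c0.
    by apply: (H [set` order_interval (- u e c) (u e c)]); exists e, c.
  move=> -> _ [e [c [ae c0 ->]]].
  have u0 := coord_dominator_ge0 ae w0 (ltW c0).
  by rewrite /order_interval/= unfold_in/= u0 andbT -lev_opp2 opprK oppr0.
Qed.

End AtomCoordinates.

Lemma cvg_initial (S : choiceType) (T : topologicalType) (f : S -> T)
    (G : set_system S) (p : S) : Filter G ->
  G --> (p : initial_topology f) <-> f @ G --> f p.
Proof.
move=> FG; split=> [Gp|Gp A].
  exact: cvg_comp Gp (@initial_continuous _ _ f p).
rewrite nbhsE => -[B [[D oD <-] Dp] BA]; apply: filterS BA _.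
by apply: Gp; exact: open_nbhs_nbhs.
Qed.

(** * Order convergence is coordinatewise convergence in the atomic case *)

Section AtomicTopology.
Context {R : realType} {F : vectorLatticeType R}.
Context (arch : archimedean_lattice F).
Context (a b : F).
Context (ab : a <= b).
Notation I := (order_interval_type a b).
Implicit Types (x y p : I) (e u : F) (c : R) (G : set_system I).

Lemma oi_val_ge x : a <= oi_val x.
Proof. by have /andP[] := oi_valP x. Qed.

Lemma oi_val_le x : oi_val x <= b.
Proof. by have /andP[] := oi_valP x. Qed.

Definition oi_coord e x : R := atom_coord e (oi_val x - a).

(** Remainders are monotone, so a gap [c] between coordinates leaves room for [c e] between the
    points. *)
Lemma oi_coord_gap e x y c : atom e -> oi_val x <= oi_val y ->
  oi_coord e x + c <= oi_coord e y -> oi_val x + c *: e <= oi_val y.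
Proof.
move=> ae xy H; have e0 : 0 < e by case: ae.
have xa : 0 <= oi_val x - a by rewrite subv_ge0 oi_val_ge.
have xya : oi_val x - a <= oi_val y - a by rewrite lev_addP.
have se : (oi_coord e x + c) *: e <= oi_coord e y *: e by rewrite lev_scale2r.
have := lev_add (coord_rem_le arch ae xa xya) se.
by rewrite scalerDl addrA !subrK addrAC lev_addP.
Qed.

Lemma oi_coord_mono e x y : atom e -> oi_val x <= oi_val y ->
  oi_coord e x <= oi_coord e y.
Proof.
by move=> ae xy; rewrite coord_mono ?lev_addP// subv_ge0 oi_val_ge.
Qed.

Lemma oi_bot_subproof : order_interval a b a.
Proof. by rewrite /order_interval /= lexx. Qed.

Lemma oi_top_subproof : order_interval a b b.
Proof. by rewrite /order_interval /= lexx andbT. Qed.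

(** If the coordinate is not eventually below that of [p] plus [c], the upper end of every interval
    in [C] has coordinate at least that much. By [oi_coord_gap], [p + c e] then lies in all these
    intervals, whose intersection is [p] alone. The lower bound is dual. *)
Lemma order_cvg_coord G p e : atom e -> ProperFilter G -> order_cvg G p ->
  oi_coord e @ G --> oi_coord e p.
Proof.
move=> ae PG [C [CG Cint Cp]]; have e0 : 0 < e by case: ae.
have pC A : C A -> A p by move=> CA; have : [set p] p by []; rewrite -Cp; apply.
have ce_neq0 c : 0 < c -> c *: e != 0.
  by move=> c0; rewrite scaler_eq0 !gt_eqF.
suff H c : 0 < c ->
    G [set x | oi_coord e p - c < oi_coord e x < oi_coord e p + c].
  apply/cvgrPdist_lt => c c0; apply: filterS (H c c0) => x /=.
  by rewrite ltr_distlC.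
move=> c0.
have Gup : G [set x | oi_coord e x < oi_coord e p + c].
  (* If [p + c e] leaves the interval at the top, no point of [I] has so large a coordinate. *)
  have [qb|qb] := boolP (oi_val p + c *: e <= b); last first.
    apply: filterE => x /=; rewrite ltNge; apply: contra qb => qx.
    have pb : oi_val p <= oi_val (OrderInterval oi_top_subproof) by exact: oi_val_le.
    apply: (oi_coord_gap ae pb); apply: le_trans qx _.
    by apply: oi_coord_mono => //; exact: oi_val_le.
  have qI : order_interval a b (oi_val p + c *: e).
    rewrite /order_interval /= qb andbT (le_trans (oi_val_ge p))//.
    by rewrite lev_addr scalev_ge0// ltW.
  apply: contrapT => nG.
  suff : [set p] (OrderInterval qI).
    move=> /(congr1 (@oi_val _ F a b))/= /eqP.
    by rewrite -subr_eq0 addrAC subrr add0r (negbTE (ce_neq0 _ c0)).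
  rewrite -Cp => A CA; have [s [t [st AE]]] := Cint A CA.
  have := pC A CA; rewrite AE /= /order_interval !unfold_in /= => /andP[sp pt].
  rewrite (le_trans sp)/=; last by rewrite leEsub /= lev_addr scalev_ge0// ltW.
  apply: (oi_coord_gap ae pt); rewrite leNgt; apply/negP => tp; apply: nG.
  apply: filterS (CG A CA) => x; rewrite AE /= /order_interval unfold_in /=.
  by move=> /andP[_ xt]; apply: le_lt_trans tp; exact: oi_coord_mono.
have Glo : G [set x | oi_coord e p - c < oi_coord e x].
  have [aq|aq] := boolP (a <= oi_val p - c *: e); last first.
    apply: filterE => x /=; rewrite ltNge; apply: contra aq => qx.
    pose bot := OrderInterval oi_bot_subproof.
    have ap : oi_val bot <= oi_val p by exact: oi_val_ge.
    rewrite lev_subr_addr; apply: (oi_coord_gap ae ap).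
    rewrite -lerBrDr; apply: le_trans qx.
    by apply: oi_coord_mono => //; exact: oi_val_ge.
  have qI : order_interval a b (oi_val p - c *: e).
    rewrite /order_interval /= aq (le_trans _ (oi_val_le p))//.
    by rewrite lev_subl scalev_ge0// ltW.
  apply: contrapT => nG.
  suff : [set p] (OrderInterval qI).
    move=> /(congr1 (@oi_val _ F a b))/= /eqP.
    by rewrite -subr_eq0 addrAC subrr add0r oppr_eq0 (negbTE (ce_neq0 _ c0)).
  rewrite -Cp => A CA; have [s [t [st AE]]] := Cint A CA.
  have := pC A CA; rewrite AE /= /order_interval !unfold_in /= => /andP[sp pt].
  rewrite (le_trans _ pt)/=; last by rewrite leEsub /= lev_subl scalev_ge0// ltW.
  rewrite andbT leEsub /= lev_subr_addr; apply: (oi_coord_gap ae sp).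
  rewrite leNgt; apply/negP => tp; apply: nG.
  apply: filterS (CG A CA) => x; rewrite AE /= /order_interval unfold_in /=.
  move=> /andP[sx _]; rewrite ltrBlDr; apply: lt_le_trans tp _.
  by rewrite lerD2r; exact: oi_coord_mono.
by apply: filterS (filterI Glo Gup) => x /= [-> ->].
Qed.

Lemma vjoin_ger (x y : F) : y <= vjoin x y.
Proof. by have := lexx (vjoin x y); rewrite vjoin_le => /andP[]. Qed.

(** Order intervals of the lattice [I] need endpoints in [I], so [x - u] and [x + u] are truncated
    to [[a, b]]. *)
Lemma oi_clamp x u : 0 <= u -> exists q r : I, q <= x <= r /\
  forall y, (q <= y <= r) = (oi_val x - u <= oi_val y <= oi_val x + u).
Proof.
move=> u0; have qI : order_interval a b (vjoin (oi_val x - u) a).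
  rewrite /order_interval /= vjoin_ger/= vjoin_le ab andbT.
  by rewrite (le_trans _ (oi_val_le x))// lev_subl.
have rI : order_interval a b (vmeet (oi_val x + u) b).
  rewrite /order_interval /= vmeet_ler andbT lev_meet ab andbT.
  by rewrite (le_trans (oi_val_ge x))// lev_addr.
have qrE y : (OrderInterval qI <= y <= OrderInterval rI) =
    (oi_val x - u <= oi_val y <= oi_val x + u).
  by rewrite !leEsub /= vjoin_le lev_meet oi_val_ge oi_val_le !andbT.
exists (OrderInterval qI), (OrderInterval rI); split => //.
by rewrite qrE lev_subl lev_addr u0.
Qed.

(** The witnesses are the truncated intervals of radius [u e c] around [p]. By [subv_le_coord] each
    contains all points whose [e]-coordinate is within [c] of that of [p]; by [atomic_eq0] they have
    only [p] in common. *)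
Lemma coord_order_cvg G p : atomic F -> ProperFilter G ->
  (forall e, atom e -> oi_coord e @ G --> oi_coord e p) -> order_cvg G p.
Proof.
move=> atF PG Gp; have w0 : 0 <= b - a by rewrite subv_ge0.
pose u e c := c *: e + (b - a - atom_coord e (b - a) *: e).
have u0 e c : atom e -> 0 < c -> 0 <= u e c.
  by move=> ae c0; apply: coord_dominator_ge0 => //; exact: ltW.
exists [set A | exists q r e c, [/\ atom e, 0 < c, q <= p <= r,
    forall y, (q <= y <= r) =
      (oi_val p - u e c <= oi_val y <= oi_val p + u e c) &
    A = [set` order_interval q r]]]; split.
- move=> _ [q [r [e [c [ae c0 _ qrE ->]]]]].
  have /cvgrPdist_lt/(_ c c0) := Gp e ae.
  apply: filterS => x; rewrite ltr_distlC ltrBlDl => /andP[/ltW px /ltW xp].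
  rewrite /= /order_interval unfold_in /= qrE lev_subl_addr.
  have ge0 y : 0 <= oi_val y - a by rewrite subv_ge0 oi_val_ge.
  have lew y : oi_val y - a <= b - a by rewrite lev_addP oi_val_le.
  have key y z : oi_coord e y - oi_coord e z <= c ->
      oi_val y <= oi_val z + u e c.
    move=> yz; rewrite addrC -lev_subl_addr.
    have -> : oi_val y - oi_val z = (oi_val y - a) - (oi_val z - a).
      by rewrite opprB addrA subrK.
    apply: le_trans (subv_le_coord arch ae (ge0 y) (lew y) (ge0 z)) _.
    by rewrite lev_addP lev_scale2r//; case: ae.
  by apply/andP; split; apply: key; rewrite lerBlDr// addrC.
- move=> _ [q [r [e [c [_ _ /andP[qp pr] _ ->]]]]].
  by exists q, r; rewrite (le_trans qp).
- apply/seteqP; split => z /=.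
    move=> H; apply: val_inj => /=; apply/eqP; rewrite -subr_eq0; apply/eqP.
    apply: (atomic_eq0 arch atF w0) => e c ae c0; rewrite -/(u e c).
    have [q [r [qpr qrE]]] := oi_clamp p (u0 e c ae c0).
    have : z \in order_interval q r.
      by apply: (H [set` order_interval q r]); exists q, r, e, c.
    rewrite unfold_in /= qrE => /andP[pz zp].
    by rewrite lev_subr_addr [- _ + _]addrC pz lev_subl_addr [u e c + _]addrC.
  by move=> -> _ [q [r [e [c [_ _ qpr _ ->]]]]].
Qed.

Lemma atomic_order_cvg_topological : atomic F -> order_cvg_topological I.
Proof.
move=> atF; pose T (e : {e : F | atom e}) : Topological I :=
  Topological.class (initial_topology (oi_coord (sval e))).
exists (Topological.class (sup_topology T)) => G p PG.
split=> [Gp|].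
  by apply/cvg_sup => -[e ae]; apply/cvg_initial; exact: order_cvg_coord.
move=> /cvg_sup Gp; apply: coord_order_cvg => // e ae.
by have /cvg_initial := Gp (exist _ e ae).
Qed.

End AtomicTopology.

(** * Disjoint pieces below an element without atoms *)

Section AtomFree.
Context {R : realType} {F : vectorLatticeType R}.
Implicit Types (x y z g f h k p q u v : F).
Context (arch : archimedean_lattice F).

Lemma sumv_ge0 (T : eqType) (s : seq T) (P : pred T) (k : T -> F) :
  (forall i, i \in s -> P i -> 0 <= k i) -> 0 <= \sum_(i <- s | P i) k i.
Proof.
move=> k0; rewrite big_seq_cond.
apply: (big_ind (fun x => 0 <= x)) => [//|x y|i /andP[]].
  exact: addv_ge0.
exact: k0.
Qed.

Lemma lev_sum (T : eqType) (s : seq T) (P : pred T) (k : T -> F) j :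
  (forall i, i \in s -> P i -> 0 <= k i) -> j \in s -> P j ->
  k j <= \sum_(i <- s | P i) k i.
Proof.
move=> k0 js Pj; rewrite (big_rem _ js) /= Pj lev_addr sumv_ge0// => i.
by move=> /mem_rem; exact: k0.
Qed.

Lemma lev_opp_meet g x y : x <= y -> g - vmeet g y <= g - vmeet g x.
Proof.
move=> xy; rewrite ![g - _]addrC lev_addP lev_opp2 lev_meet vmeet_lel/=.
exact: le_trans (vmeet_ler _ _) xy.
Qed.

Lemma subv_meet_bounds g x : 0 <= g -> 0 <= x -> 0 <= g - vmeet g x <= g.
Proof. by move=> g0 x0; rewrite subv_ge0 vmeet_lel lev_subl vmeet_ge0. Qed.

Lemma lt0v_meet g x : ~~ (g <= x) -> 0 < g - vmeet g x.
Proof.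
move=> gx; rewrite lt_neqAle subv_ge0 vmeet_lel andbT.
apply: contra gx => /eqP gE.
by rewrite -[g](subrK (vmeet g x)) -gE add0r vmeet_ler.
Qed.

(** For [f] in [[0, h]], the positive parts of [f - c h] and [c h - f] are disjoint. If [h] does not
    split, one of them vanishes for each [c] in [[0, 1]], so [f] is comparable with every multiple
    of [h], and the Archimedean property makes [f] the supremal multiple [sup S *: h]. *)
Lemma disjoint_split h : 0 < h -> ~ atom h ->
  exists p q, [/\ 0 < p <= h, 0 < q <= h & vmeet p q = 0].
Proof.
move=> h0 nh; apply: contrapT => nsplit; apply: nh; split=> // f /andP[f0 fh].
have cmp (c : R) : c *: h <= f \/ f <= c *: h.
  have [c0|c0] := leP 0 c; last first.
    by left; apply: le_trans f0; rewrite -(scale0r h) lev_scale2r// ltW.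
  have [c1|c1] := leP c 1; last first.
    by right; apply: (le_trans fh); rewrite -{1}(scale1r h) lev_scale2r// ltW.
  have ch0 : 0 <= c *: h by rewrite scalev_ge0// ltW.
  have ch1 : c *: h <= h by rewrite -{2}(scale1r h) lev_scale2r.
  apply: contrapT => /not_orP[/negP chf /negP fch]; apply: nsplit.
  exists (f - vmeet f (c *: h)), (c *: h - vmeet f (c *: h)); split.
  - rewrite lt0v_meet//= (le_trans _ fh)//.
    by have /andP[] := subv_meet_bounds f0 ch0.
  - rewrite vmeetC lt0v_meet//= (le_trans _ ch1)//.
    by have /andP[] := subv_meet_bounds ch0 f0.
  - exact: subv_meet_disjoint.
pose S : set R := [set c | c *: h <= f].
have S1 c : S c -> c <= 1.
  by move=> Sc; rewrite -(lev_scale2r _ _ h0) scale1r (le_trans Sc).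
have supS : has_sup S by split; [exists 0; rewrite /S/= scale0r|exists 1].
have le_sup c : S c -> c <= sup S by move=> Sc; apply: ub_le_sup => //; exists 1.
exists (sup S); apply/eqP; rewrite eq_le; apply/andP; split.
  rewrite -subv_ge0 -lev_opp2 oppr0 opprB.
  apply: (archi_eps arch (ltW h0)) => e e0.
  rewrite lev_subl_addr -scalerDl; case: (cmp (e + sup S)) => // /le_sup.
  by rewrite gerDr leNgt e0.
rewrite -subv_ge0 -lev_opp2 oppr0 opprB.
apply: (archi_eps arch (ltW h0)) => e e0.
have [c Sc ec] := sup_adherent e0 supS.
rewrite lev_subl_addr addrC -lev_subl_addr -scalerBl (le_trans _ Sc)//.
by rewrite lev_scale2r// ltW.
Qed.

Context (g : F).
Context (g0 : 0 < g).
Context (atom_free : forall f, 0 <= f <= g -> ~ atom f).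

Lemma atom_free_split h : 0 < h <= g ->
  exists p q, [/\ 0 < p <= h, 0 < q <= h & vmeet p q = 0].
Proof.
move=> /andP[h0 hg]; apply: disjoint_split => //.
by apply: atom_free; rewrite hg ltW.
Qed.

(** Induction on [s]. If [v a] meets an earlier piece [k i], that meet is split in two: one half
    replaces [k i], the other serves [a] and stays disjoint from the remaining pieces because it is
    below the old [k i]. *)
Lemma disjoint_refinement (T : eqType) (s : seq T) (v : T -> F) :
  (forall i, i \in s -> 0 < v i <= g) ->
  exists k : T -> F, (forall i, i \in s -> 0 < k i <= v i) /\
    {in s &, forall i j, i != j -> vmeet (k i) (k j) = 0}.
Proof.
elim: s => [|a s IHs] vs; first by exists v.
have [k [kv kd]] := IHs (fun i si => vs i (mem_behead (s := a :: s) si)).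
(* Pieces are indexed by values, so a repeated entry keeps the piece it already has. *)
have [as_|as_] := boolP (a \in s).
  have as_s i : (i \in a :: s) = (i \in s).
    by rewrite inE; case: eqP => // ->.
  exists k; split=> [i|i j]; rewrite !as_s; [exact: kv|exact: kd].
have /andP[va0 vag] := vs a (mem_head _ _).
suff [q [k' [/andP[q0 qv] k'k qk']]] : exists q (k' : T -> F),
    [/\ 0 < q <= v a, forall i, i \in s -> 0 < k' i <= k i &
        forall i, i \in s -> vmeet q (k' i) = 0].
  have sa i : i \in s -> (i == a) = false.
    by move=> si; apply: contraNF as_ => /eqP <-.
  exists (fun i => if i == a then q else k' i); split=> [i|i j].
    rewrite inE; case: eqP => [->|_ /= si]; first by rewrite q0.
    have /andP[k'0 k'ki] := k'k i si; have /andP[_ kvi] := kv i si.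
    by rewrite k'0 (le_trans k'ki).
  rewrite !inE; case: (eqVneq i a) => [->|_]; case: (eqVneq j a) => [->|_] //=.
  - by move=> _ sj _; exact: qk'.
  - by move=> si _ _; rewrite vmeetC; exact: qk'.
  - move=> si sj ij; have /andP[k'i0 k'ki] := k'k i si.
    have /andP[k'j0 k'kj] := k'k j sj.
    by apply: disjointW k'ki _ k'kj (kd i j si sj ij); exact: ltW.
have [[i [si vki]]|nki] := pselect (exists i, i \in s /\ vmeet (v a) (k i) != 0).
  have /andP[ki0 kivi] := kv i si.
  have [p [q [/andP[p0 pm] /andP[q0 qm] pq]]] :
      exists p q, [/\ 0 < p <= vmeet (v a) (k i), 0 < q <= vmeet (v a) (k i) &
        vmeet p q = 0].
    apply: atom_free_split; rewrite lt_neqAle eq_sym vki.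
    rewrite (le_trans (vmeet_lel _ _) vag) andbT.
    by rewrite vmeet_ge0// ltW.
  have pki := le_trans pm (vmeet_ler _ _).
  have qki := le_trans qm (vmeet_ler _ _).
  exists q, (fun j => if j == i then p else k j); split.
  - by rewrite q0 (le_trans qm)// vmeet_lel.
  - move=> j sj; case: eqP => [->|_]; first by rewrite p0.
    by have /andP[-> _] := kv j sj; rewrite lexx.
  - move=> j sj; case: (eqVneq j i) => [_|ji]; first by rewrite vmeetC.
    have /andP[kj0 _] := kv j sj.
    apply: (disjointW (ltW q0) qki (ltW kj0) (lexx _)).
    by apply: kd => //; rewrite eq_sym.
exists (v a), k; split.
- by rewrite va0 lexx.
- by move=> i si; have /andP[-> _] := kv i si; rewrite lexx.
- by move=> i si; apply/eqP; apply: contra_notT nki => vki; exists i.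
Qed.

(** Split repeatedly: keep the first half as [d n] and go on inside the second half [r n.+1], which
    contains all later terms and is disjoint from [d n]. *)
Lemma disjoint_sequence h : 0 < h <= g ->
  exists d : nat -> F, (forall n, 0 < d n <= h) /\
    forall m n, (m < n)%N -> vmeet (d m) (d n) = 0.
Proof.
move=> h0g.
pose split_of q (pq : F * F) := 0 < q <= g ->
  [/\ 0 < pq.1 <= q, 0 < pq.2 <= q & vmeet pq.1 pq.2 = 0].
have /choice[f fP] q : exists pq, split_of q pq.
  have [/atom_free_split[p [p' H]]|/negP nq] := boolP (0 < q <= g).
    by exists (p, p').
  by exists (q, q) => /nq.
pose r n := iter n (fun q => (f q).2) h.
have rg n : 0 < r n <= g.
  elim: n => [//|n IHn]; have [_ /andP[r0 rr] _] := fP _ IHn.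
  by rewrite /= r0 (le_trans rr)//; have /andP[] := IHn.
have rS n : r n.+1 <= r n by have [_ /andP[]] := fP _ (rg n).
have r_le m n : (m <= n)%N -> r n <= r m.
  elim: n => [|n IHn]; first by rewrite leqn0 => /eqP ->.
  by rewrite leq_eqVlt => /predU1P[->//|/IHn]; exact: le_trans.
exists (fun n => (f (r n)).1); split=> [n|m n mn].
  have [/andP[d0 dr] _ _] := fP _ (rg n).
  by rewrite d0 (le_trans dr)//; exact: (r_le 0%N).
have [/andP[dm0 _] _ dm] := fP _ (rg m).
have [/andP[dn0 dnr] _ _] := fP _ (rg n).
apply: (disjointW (ltW dm0) (lexx _) (ltW dn0) _ dm).
exact: le_trans dnr (r_le m.+1 n mn).
Qed.

End AtomFree.

(** * Failure of both properties on an atom-free interval *)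

Section AtomFreeInterval.
Context {R : realType} {F : vectorLatticeType R}.
Context (arch : archimedean_lattice F).
Context (g : F).
Context (g0 : 0 < g).
Context (atom_free : forall f : F, 0 <= f <= g -> ~ atom f).
Notation I := (order_interval_type 0 g).
Implicit Types (x y z : I) (c h k u v l : F) (G : set_system I).

Lemma disjoint_seq_order_cvg (x_ : nat -> I) (p : I) : oi_val p = 0 ->
  (forall m n, (m < n)%N -> vmeet (oi_val (x_ m)) (oi_val (x_ n)) = 0) ->
  order_cvg (x_ @ \oo) p.
Proof.
move=> pE xd; have pge y : p <= y by rewrite leEsub /= pE oi_val_ge.
exists [set A | exists2 q : I, (\forall n \near \oo, x_ n <= q) &
  A = [set` order_interval p q]]; split.
- move=> _ [q xq ->]; apply: filterS xq => n xnq.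
  by rewrite /= /order_interval unfold_in /= pge.
- by move=> _ [q _ ->]; exists p, q.
- apply/seteqP; split=> z /=; last first.
    by move=> -> _ [q _ ->]; rewrite /= /order_interval unfold_in /= lexx pge.
  move=> zC.
  (* If [c] is eventually disjoint from the sequence, [disjoint_addv_le] makes the positive part of
     [g - c] an eventual upper bound, hence a bound for [z]. *)
  have z_le c : 0 <= c ->
      (\forall n \near \oo, vmeet (oi_val (x_ n)) c = 0) ->
      oi_val z <= g - vmeet g c.
    move=> c0 xc; have qI : order_interval 0 g (g - vmeet g c).
      by rewrite /order_interval subv_meet_bounds// ltW.
    have : z \in order_interval p (OrderInterval qI).
      apply: (zC [set` _]); exists (OrderInterval qI) => //.
      apply: filterS xc => n xnc; rewrite leEsub /= lev_subr_addr.
      apply: disjoint_addv_le; rewrite ?vmeet_lel ?oi_val_le//.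
      apply: disjointW xnc; rewrite ?oi_val_ge ?vmeet_ler//.
      by rewrite vmeet_ge0// ltW.
    by rewrite unfold_in /= => /andP[_]; rewrite leEsub.
  have z0 := oi_val_ge z.
  (* Multiples of [x_ i] are disjoint from all later terms; used as [c], they contradict [archi_cut]
     for the meet of [x_ i] and [z]. Afterwards multiples of [z] itself are admissible, which forces
     [z = 0]. *)
  have xz i : vmeet (oi_val (x_ i)) (oi_val z) = 0.
    apply/eqP; rewrite eq_sym; apply/negPn/negP => k0.
    have k_gt0 : 0 < vmeet (oi_val (x_ i)) (oi_val z).
      by rewrite lt_neqAle k0 vmeet_ge0// oi_val_ge.
    have [N /negP] := archi_cut arch (ltW g0) k_gt0; apply.
    apply: (le_trans (vmeet_ler _ _)).
    apply: le_trans (z_le (N%:R *: oi_val (x_ i)) _ _) _.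
    - by rewrite scalev_ge0 ?oi_val_ge.
    - exists i.+1 => // n /= ni; apply: disjointZ; rewrite ?oi_val_ge//.
      by rewrite vmeetC xd.
    - apply: lev_opp_meet; apply: lev_wscale2l; first exact: ler0n.
      exact: vmeet_lel.
  apply: val_inj => /=; rewrite pE; apply/eqP; rewrite eq_sym.
  apply/negPn/negP => zn0; have zgt0 : 0 < oi_val z by rewrite lt_neqAle zn0.
  have [N /negP] := archi_cut arch (ltW g0) zgt0; apply; apply: z_le.
    by rewrite scalev_ge0.
  by apply: nearW => n; rewrite disjointZ ?oi_val_ge.
Qed.

Lemma atom_free_order_cvg_not_topological : ~ order_cvg_topological I.
Proof.
move=> [tau tauP].
have pI : order_interval 0 g (0 : F) by rewrite /order_interval lexx ltW.
have gI : order_interval 0 g g by rewrite /order_interval lexx ltW.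
pose p : I := OrderInterval pI; pose q : I := OrderInterval gI.
pose N0 : set_system I := nbhs (p : Topological.Pack tau).
have PN : ProperFilter N0 by exact: (@nbhs_pfilter (Topological.Pack tau)).
have [C [CN Cint Cp]] : order_cvg N0 p by apply/tauP.
have [A CA nAq] : exists2 A, C A & ~ A q.
  apply: contrapT => H; suff : [set p] q.
    by move=> /(congr1 (@oi_val _ F 0 g)) /= gE; move: (g0); rewrite gE ltxx.
  rewrite -Cp => A CA; apply: contrapT => nAq; apply: H; by exists A.
have pA : A p by have : [set p] p by []; rewrite -Cp; apply.
have [s [t [_ AE]]] := Cint A CA; rewrite AE /= in pA nAq.
(* The lower end [s] is below [p], hence below [q], so only the upper end [t] can exclude [q] from
   [A]. *)
have tq : ~~ (g <= oi_val t).
  apply/negP => gt; apply: nAq; move: pA; rewrite !unfold_in /= => /andP[sp _].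
  by rewrite (le_trans sp) ?leEsub //= ltW.
have hg : 0 < g - oi_val t <= g.
  rewrite lev_subl oi_val_ge andbT lt_neqAle subv_ge0 oi_val_le andbT.
  by apply: contra tq; rewrite eq_sym subr_eq0 le_eqVlt => ->.
have [d [dh dd]] := disjoint_sequence arch atom_free hg.
(* This choice keeps [x_ n] out of [[s, t]]: from [x_ n <= t] would follow
   [d n <= g - t <= g - x_ n]. *)
have /choice[N NP] n : exists N : nat, ~~ (d n <= g - vmeet g (N%:R *: d n)).
  by apply: archi_cut (ltW g0) _ => //; have /andP[] := dh n.
have d0 n : 0 <= d n by have /andP[/ltW] := dh n.
have Nd0 n : 0 <= (N n)%:R *: d n by rewrite scalev_ge0.
have xI n : order_interval 0 g (vmeet g ((N n)%:R *: d n)).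
  by rewrite /order_interval /= vmeet_lel vmeet_ge0// ltW.
pose x_ n : I := OrderInterval (xI n).
have xp : order_cvg (x_ @ \oo) p.
  apply: disjoint_seq_order_cvg => // m n mn /=.
  have g0' := ltW g0.
  apply: (@disjointW _ _ ((N m)%:R *: d m) _ ((N n)%:R *: d n));
    rewrite ?vmeet_ge0 ?vmeet_ler//.
  by rewrite disjointZ// vmeetC disjointZ// vmeetC dd.
have /tauP := xp => /(_ _) Gp.
have [n _ xA] : (x_ @ \oo) A by apply: Gp; exact: CN.
have := xA n (leqnn n); rewrite AE /= unfold_in /= => /andP[_ xt].
move/negP: (NP n); apply; have /andP[_ dnh] := dh n.
by rewrite (le_trans dnh)// ![g - _]addrC lev_addP lev_opp2.
Qed.

(** Refine the entries to disjoint pieces [k i] and let [x] be the positive part of [g - K], where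
    [K] sums large multiples of the pieces flagged [false]. Those pieces are cut out of [x] by
    [archi_cut], while the pieces flagged [true] are disjoint from [K] and cannot lie below
    [g - x]. *)
Lemma atom_free_disjoint_witness (s : seq (F * bool)) :
  (forall i, i \in s -> 0 < i.1 <= g) ->
  exists x, forall i, i \in s ->
    if i.2 then ~ (oi_val x <= g - i.1) else ~ (i.1 <= oi_val x).
Proof.
move=> sg; have [k [ks kd]] := disjoint_refinement arch atom_free sg.
have k0 i : i \in s -> 0 <= k i by move=> /ks/andP[/ltW].
have /choice[N NP] i : exists N : nat,
    i \in s -> ~~ (k i <= g - vmeet g (N%:R *: k i)).
  have [si|] := boolP (i \in s); last by exists 0%N.
  by have [|N] := @archi_cut _ _ arch g (k i) (ltW g0);
    [have /andP[] := ks i si|exists N].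
have Nk0 i : i \in s -> ~~ i.2 -> 0 <= (N i)%:R *: k i.
  by move=> /k0 ki0 _; rewrite scalev_ge0.
pose K := \sum_(i <- s | ~~ i.2) (N i)%:R *: k i.
have K0 : 0 <= K by exact: sumv_ge0.
have xI : order_interval 0 g (g - vmeet g K).
  by rewrite /order_interval subv_meet_bounds// ltW.
exists (OrderInterval xI) => i si /=; have /andP[ki0 kii] := ks i si.
case: ifP => i2.
  rewrite ![g - _]addrC lev_addP lev_opp2 => iK.
  suff ki_eq0 : k i = 0 by rewrite ki_eq0 ltxx in ki0.
  apply: (@disjoint_eq0 _ _ _ K).
    exact: le_trans kii (le_trans iK (vmeet_ler _ _)).
  apply: (disjoint_sum (ltW ki0) _).2 => j sj j2; split; first exact: Nk0.
  apply: disjointZ; rewrite ?k0//; apply: kd => //.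
  by apply: contraNneq j2 => <-; rewrite i2.
move=> ix; move/negP: (NP i si); apply.
apply: (le_trans kii); apply: (le_trans ix); apply: lev_opp_meet.
by apply: (lev_sum Nk0); rewrite ?i2.
Qed.

Lemma atom_free_spread_ultrafilter : exists G, [/\ UltraFilter G,
  forall Z u, G Z -> (forall z, Z z -> oi_val z <= u) -> g <= u &
  forall Z l, G Z -> (forall z, Z z -> l <= oi_val z) -> l <= 0].
Proof.
pose D := [set s : seq (F * bool) | forall i, i \in s -> 0 < i.1 <= g].
pose B (s : seq (F * bool)) := [set x : I | forall i, i \in s ->
  if i.2 then ~ (oi_val x <= g - i.1) else ~ (i.1 <= oi_val x)].
have PB : ProperFilter (filter_from D B).
  apply: filter_from_proper; last first.
    by move=> s /atom_free_disjoint_witness[x]; exists x.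
  apply: filter_from_filter; first by exists [::].
  move=> s t Ds Dt; exists (s ++ t).
    by move=> i; rewrite mem_cat => /orP[/Ds|/Dt].
  by move=> x xst; split=> i si; apply: xst; rewrite mem_cat si ?orbT.
have [G [UG BG]] := ultraFilterLemma PB.
have GB i : 0 < i.1 <= g -> G (B [:: i]).
  by move=> ig; apply: BG; exists [:: i] => // j; rewrite mem_seq1 => /eqP ->.
exists G; split=> // Z w GZ Zw.
- have [x0 Zx0] := filter_ex GZ.
  have w0 : 0 <= w by apply: le_trans (oi_val_ge x0) (Zw _ Zx0).
  (* For [v] the positive part of [g - w], [g - v] is the meet of [g] and [w], an upper bound of
     [Z]; but [Z] meets the member of [G] that forbids [x <= g - v]. *)
  apply/negPn/negP => gw; have vg : 0 < g - vmeet g w <= g.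
    by rewrite lt0v_meet// lev_subl vmeet_ge0// ltW.
  have [x [Zx /(_ _ (mem_head _ _))]] := filter_ex (filterI GZ (GB (_, true) vg)).
  by apply => /=; rewrite opprB addrC subrK lev_meet oi_val_le Zw.
(* Points of [I] are nonnegative, so the positive part of a lower bound is again a lower bound. *)
- apply/negPn/negP => w0; have wm z : Z z -> w - vmeet w 0 <= oi_val z.
    move=> Zz; rewrite lev_subl_addr addrC -lev_subl_addr lev_meet.
    by rewrite lev_subl oi_val_ge lev_subl_addr add0r Zw.
  have [x0 Zx0] := filter_ex GZ.
  have vg : 0 < w - vmeet w 0 <= g.
    by rewrite lt0v_meet//= (le_trans (wm _ Zx0))// oi_val_le.
  have [x [Zx /(_ _ (mem_head _ _))]] := filter_ex (filterI GZ (GB (_, false) vg)).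
  by apply; exact: wm.
Qed.

(** If [Z] is in [G] and its differences lie in [[s, t]], then [t + y] bounds [Z] above for each [y]
    in [Z], so [g - t <= y]; thus [g - t] bounds [Z] below and [g <= t]. Hence [g] lies in every
    interval of [C], whose intersection should be 0 alone. *)
Lemma atom_free_not_order_precompact : ~ order_precompact 0 g.
Proof.
have [G [UG Gup Glo]] := atom_free_spread_ultrafilter.
move=> /(_ G UG) [C [CG Cint C0]].
suff : [set 0 : F] g by move=> /= gE; move: (g0); rewrite gE ltxx.
rewrite -C0 => A CA; have [s [t [_ AE]]] := Cint A CA.
have [[X Y] /= [GX GY] XYA] := CG A CA.
have GZ : G (X `&` Y) by exact: filterI.
have st x y : (X `&` Y) x -> (X `&` Y) y -> s <= oi_val x - oi_val y <= t.
  move=> [Xx _] [_ Yy]; have : A (oi_val x - oi_val y).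
    by apply: XYA; exists x => //; exists y.
  by rewrite AE /= unfold_in.
have [z Zz] := filter_ex GZ.
rewrite AE /= /order_interval unfold_in /=; apply/andP; split.
  have /andP[] := st z z Zz Zz; rewrite subrr => s0 _.
  by rewrite (le_trans s0)// ltW.
rewrite -subv_ge0 -lev_opp2 oppr0 opprB.
apply: (Glo _ _ GZ) => y Zy; rewrite lev_subl_addr.
apply: (Gup _ _ GZ) => x Zx; rewrite addrC -lev_subl_addr.
by have /andP[] := st x y Zx Zy.
Qed.

End AtomFreeInterval.

Lemma not_atomicP (R : realType) (F : vectorLatticeType R) : ~ atomic F ->
  exists2 g : F, 0 < g & forall f, 0 <= f <= g -> ~ atom f.
Proof.
move=> natF; apply: contrapT => H; apply: natF => g g0.
apply: contrapT => nf; apply: H; exists g => // f fg af.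
by apply: nf; exists f.
Qed.

Theorem theorem4p5 (R : realType) (F : vectorLatticeType R) :
  archimedean_lattice F ->
  [<-> atomic F;
       forall a b : F, a <= b -> order_precompact a b;
       forall a b : F, a <= b -> order_cvg_topological (order_interval_type a b)].
Proof.
move=> arch.
(* Pre-compactness implies the topological property only by way of atomicity. *)
have precompact_atomic :
    (forall a b : F, a <= b -> order_precompact a b) -> atomic F.
  move=> H; apply: contrapT => /not_atomicP[g g0 gP].
  exact: (atom_free_not_order_precompact arch g0 gP (H _ _ (ltW g0))).
split; last split.
- by move=> atF a b; exact: atomic_order_precompact.
- move=> /precompact_atomic atF a b ab.
  exact: atomic_order_cvg_topological.
- move=> H; apply: contrapT => /not_atomicP[g g0 gP].
  exact: (atom_free_order_cvg_not_topological arch g0 gP (H _ _ (ltW g0))).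
Qed.
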